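(* Let $H$ be a Hopf algebra over a field $\mathbb{F}$ of characteristic $0$, with comultiplication $\Delta$ and counit $\varepsilon$, let $A$ be an associative $H$-pseudoalgebra, and let $M$ be a bimodule over $A$. For $u\in M$ define $f_u:A\to M$ by $$f_u(a)=\big[(\mathrm{id}\otimes\varepsilon)\otimes_H \mathrm{id}_M\big](a*u)-\big[(\varepsilon\otimes\mathrm{id})\otimes_H\mathrm{id}_M\big](u*a),\qquad a\in A.$$ Then $f_u$ is $H$-linear and it is a derivation from $A$ to $M$. Hence $d_1\circ d_0=0$, where $d_0:C^0(A,M)\to C^1(A,M)$ and $d_1:C^1(A,M)\to C^2(A,M)$ are the Hochschild differentials of $A$ with coefficients in $M$.
   Context: All tensor products without subscript are over $\mathbb{F}$. $H^{\otimes n}$ is a right $H$-module via $F\cdot h=F\,\Delta^{(n-1)}(h)$, where $\Delta^{(n-1)}:H\to H^{\otimes n}$ is the iterated comultiplication ($\Delta^{(0)}=\mathrm{id}$), and $H^{\otimes n}\otimes_H V$ is formed with this structure, for $V$ a left $H$-module. A map $*:V_1\otimes V_2\to H^{\otimes 2}\otimes_H V_3$ ($V_i$ left $H$-modules) is $H^{\otimes2}$-linear if $(hv_1)*(gv_2)=((h\otimes g)\otimes_H 1)(v_1*v_2)$. Such an operation extends to $(H^{\otimes n}\otimes_H V_1)\otimes(H^{\otimes m}\otimes_H V_2)\to H^{\otimes(n+m)}\otimes_H V_3$ by $$(F\otimes_H v_1)*(G\otimes_H v_2)=\sum_i (F\otimes G)\,(\Delta^{(n-1)}\otimes\Delta^{(m-1)})(g_i)\otimes_H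 w_i,\quad\text{if } v_1*v_2=\sum_i g_i\otimes_H w_i$$ (composition rule; elements of $V$ are identified with elements of $H\otimes_H V\simeq V$). An associative $H$-pseudoalgebra is a left $H$-module $A$ with an $H^{\otimes2}$-linear map $*:A\otimes A\to H^{\otimes2}\otimes_H A$ with $(a*b)*c=a*(b*c)$ in $H^{\otimes3}\otimes_H A$. A bimodule over $A$ is a left $H$-module $M$ with $H^{\otimes2}$-linear maps $*:A\otimes M\to H^{\otimes2}\otimes_H M$ and $*:M\otimes A\to H^{\otimes2}\otimes_H M$ such that $(a*b)*u=a*(b*u)$, $(u*a)*b=u*(a*b)$, $(a*u)*b=a*(u*b)$ in $H^{\otimes 3}\otimes_H M$ for all $a,b\in A$, $u\in M$. The map $(\mathrm{id}\otimes\varepsilon)\otimes_H\mathrm{id}_M: H^{\otimes2}\otimes_H M\to H\otimes_H M\simeq M$ sends $\sum_i(h_i\otimes k_i)\otimes_H u_i$ to $\sum_i h_i\varepsilon(k_i)u_i$, and $(\varepsilon\otimes\mathrm{id})\otimes_H\mathrm{id}_M$ sends it to $\sum_i\varepsilon(h_i)k_iu_i$. A derivation from $A$ to $M$ is an $H$-linear map $f:A\to M$ with $f(a*b)=a*f(b)+f(a)*b$ in $H^{\otimes2}\otimes_H M$ for all $a,b\in A$, where $f(a*b)$ means $(\mathrm{id}_{H^{\otimes2}}\otimes_H f)(a*b)$. Low-degree Hochschild complex: $C^0(A,M)=\mathbb{F}\otimes_H M\simeq M/H^+M$ with $H^+=\ker\varepsilon$ (and $H$ acting on $\mathbb{F}$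 through $\varepsilon$); $C^1(A,M)=\mathrm{Hom}_H(A,M)$; $C^2(A,M)$ is the space of $H^{\otimes 2}$-linear maps $A\otimes A\to H^{\otimes2}\otimes_H M$. The differential $d_0$ sends the class of $u\in M$ to $f_u$ (this is well defined on $M/H^+M$), and $(d_1\varphi)(a,b)=a*\varphi(b)-\varphi(a*b)+\varphi(a)*b$, with $\varphi(a*b)=(\mathrm{id}_{H^{\otimes2}}\otimes_H\varphi)(a*b)$. *)

(* Defs.v *)
From HB Require Import structures.
From mathcomp Require Import all_boot all_order all_algebra.
From mathcomp Require Import generic_quotient boolp.

Set Implicit Arguments.
Unset Strict Implicit.
Unset Printing Implicit Defensive.

Import GRing.Theory.
Local Open Scope ring_scope.
Local Open Scope quotient_scope.

(* The left K-module generated by X subject to relations R between formal     *)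
(* sums; (k, x) : K * X stands for the summand k x.                           *)
Section PresentedModule.
Variables (K : pzRingType) (X : choiceType).
Variable R : seq (K * X) -> seq (K * X) -> Prop.
Implicit Types (s t u : seq (K * X)) (k l : K) (x : X).

Definition fscale k s := [seq (k * p.1, p.2) | p <- s].

Inductive fsum_eq : seq (K * X) -> seq (K * X) -> Prop :=
| FsumRefl s : fsum_eq s s
| FsumSym s t : fsum_eq s t -> fsum_eq t s
| FsumTrans s t u : fsum_eq s t -> fsum_eq t u -> fsum_eq s u
| FsumCat s s' t t' : fsum_eq s s' -> fsum_eq t t' -> fsum_eq (s ++ t) (s' ++ t')
| FsumComm s t : fsum_eq (s ++ t) (t ++ s)
| FsumAdd k l x : fsum_eq [:: (k + l, x)] [:: (k, x); (l, x)]
| FsumZero x : fsum_eq [:: (0, x)] [::]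
| FsumRel k s t : R s t -> fsum_eq (fscale k s) (fscale k t).

Definition fsum_eqb s t := `[< fsum_eq s t >].

Lemma fsum_eqb_refl : reflexive fsum_eqb.
Proof. by move=> s; apply/asboolP; exact: FsumRefl. Qed.

Lemma fsum_eqb_sym : symmetric fsum_eqb.
Proof. by move=> s t; apply/asboolP/asboolP; exact: FsumSym. Qed.

Lemma fsum_eqb_trans : transitive fsum_eqb.
Proof.
move=> t s u /asboolP st /asboolP tu; apply/asboolP.
exact: FsumTrans st tu.
Qed.

Canonical fsum_equiv :=
  EquivRel fsum_eqb fsum_eqb_refl fsum_eqb_sym fsum_eqb_trans.

Definition pres := {eq_quot fsum_equiv}.
HB.instance Definition _ := Choice.on pres.
HB.instance Definition _ := EqQuotient.on pres.

Definition fsum s : pres := \pi_pres s.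

Lemma fsumP s t : fsum_eq s t -> fsum s = fsum t.
Proof. by move=> st; apply/eqP; rewrite /fsum eqmodE; apply/asboolP. Qed.

Lemma fsum_repr (a : pres) : fsum (repr a) = a.
Proof. exact: reprK. Qed.

Lemma fsum_eq_repr s : fsum_eq (repr (fsum s)) s.
Proof.
have /eqP := fsum_repr (fsum s).
by rewrite /fsum eqmodE => /asboolP.
Qed.

Lemma fscale_cat k s t : fscale k (s ++ t) = fscale k s ++ fscale k t.
Proof. exact: map_cat. Qed.

Lemma fscale_fscale k l s : fscale k (fscale l s) = fscale (k * l) s.
Proof. by rewrite /fscale -map_comp; apply: eq_map => p /=; rewrite mulrA. Qed.

Lemma fsum_eq_scale k s t : fsum_eq s t -> fsum_eq (fscale k s) (fscale k t).
Proof.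
elim=> {s t}.
- by move=> s; exact: FsumRefl.
- by move=> s t _; exact: FsumSym.
- by move=> s t u _ IH1 _; exact: FsumTrans.
- by move=> *; rewrite !fscale_cat; exact: FsumCat.
- by move=> *; rewrite !fscale_cat; exact: FsumComm.
- by move=> l l' x; rewrite /fscale /= mulrDr; exact: FsumAdd.
- by move=> x; rewrite /fscale /= mulr0; exact: FsumZero.
- by move=> l s t Rst; rewrite !fscale_fscale; exact: FsumRel.
Qed.

Definition padd (a b : pres) := fsum (repr a ++ repr b).
Definition pscale k (a : pres) := fsum (fscale k (repr a)).
Definition popp (a : pres) := pscale (-1) a.
Definition pzero := fsum [::].

Lemma padd_fsum s t : padd (fsum s) (fsum t) = fsum (s ++ t).
Proof. by apply: fsumP; apply: FsumCat; exact: fsum_eq_repr. Qed.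

Lemma pscale_fsum k s : pscale k (fsum s) = fsum (fscale k s).
Proof. by apply: fsumP; apply: fsum_eq_scale; exact: fsum_eq_repr. Qed.

Lemma paddA : associative padd.
Proof.
move=> a b c; rewrite -(fsum_repr a) -(fsum_repr b) -(fsum_repr c).
by rewrite !padd_fsum catA.
Qed.

Lemma paddC : commutative padd.
Proof. by move=> a b; apply: fsumP; exact: FsumComm. Qed.

Lemma padd0 : left_id pzero padd.
Proof. by move=> a; rewrite -(fsum_repr a) padd_fsum. Qed.

Lemma fsum_eq_scaleD k l s : fsum_eq (fscale (k + l) s) (fscale k s ++ fscale l s).
Proof.
elim: s => [|[m x] s IHs] /=; first exact: FsumRefl.
rewrite mulrDl.
apply: (@FsumTrans _ ([:: (k * m, x); (l * m, x)] ++ (fscale k s ++ fscale l s))).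
  by rewrite -cat1s; apply: FsumCat IHs; exact: FsumAdd.
rewrite /= -cat1s -[X in fsum_eq _ X]cat1s.
apply: FsumCat; first exact: FsumRefl.
rewrite -[X in fsum_eq X _]cat1s -[_ :: fscale l s]cat1s !catA.
by apply: FsumCat; [exact: FsumComm | exact: FsumRefl].
Qed.

Lemma fsum_eq_scale0 s : fsum_eq (fscale 0 s) [::].
Proof.
elim: s => [|[m x] s IHs] /=; first exact: FsumRefl.
rewrite mul0r -cat1s -[X in fsum_eq _ X]cat0s.
by apply: FsumCat IHs; exact: FsumZero.
Qed.

Lemma fscale1 s : fscale 1 s = s.
Proof. by rewrite /fscale -[RHS]map_id; apply: eq_map => -[k x] /=; rewrite mul1r. Qed.

Lemma paddN : left_inverse pzero popp padd.
Proof.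
move=> a; rewrite -(fsum_repr a) /popp pscale_fsum padd_fsum.
rewrite -[X in _ ++ X]fscale1; apply: fsumP.
apply: FsumTrans (FsumSym (fsum_eq_scaleD _ _ _)) _.
by rewrite addNr; exact: fsum_eq_scale0.
Qed.

HB.instance Definition _ := GRing.isZmodule.Build pres paddA paddC padd0 paddN.

Lemma fsumD s t : fsum (s ++ t) = fsum s + fsum t.
Proof. by rewrite -padd_fsum. Qed.

Lemma pscaleA k l a : pscale k (pscale l a) = pscale (k * l) a.
Proof. by rewrite -(fsum_repr a) !pscale_fsum fscale_fscale. Qed.

Lemma pscale1 : left_id 1 pscale.
Proof. by move=> a; rewrite /pscale fscale1 fsum_repr. Qed.

Lemma pscaleDr : right_distributive pscale +%R.
Proof.
move=> k a b; rewrite -(fsum_repr a) -(fsum_repr b) -fsumD.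
by rewrite !pscale_fsum fscale_cat fsumD.
Qed.

Lemma pscaleDl a : {morph pscale^~ a : k l / k + l}.
Proof.
move=> k l /=; rewrite -(fsum_repr a) !pscale_fsum -fsumD; apply: fsumP.
exact: fsum_eq_scaleD.
Qed.

HB.instance Definition _ := GRing.Zmodule_isLmodule.Build K pres
  pscaleA pscale1 pscaleDr pscaleDl.

Definition pgen k x : pres := fsum [:: (k, x)].

Lemma pscale_gen k l x : k *: pgen l x = pgen (k * l) x.
Proof. exact: pscale_fsum. Qed.

Lemma pgenD k l x : pgen (k + l) x = pgen k x + pgen l x.
Proof. by rewrite -fsumD; apply: fsumP; exact: FsumAdd. Qed.

Lemma fsumE s : fsum s = \sum_(p <- s) pgen p.1 p.2.
Proof.
elim: s => [|[k x] s IHs]; first by rewrite big_nil.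
by rewrite big_cons -IHs -fsumD.
Qed.

Lemma pgen_rel s t : R s t ->
  \sum_(p <- s) pgen p.1 p.2 = \sum_(p <- t) pgen p.1 p.2.
Proof.
move=> Rst; rewrite -!fsumE; apply: fsumP.
by rewrite -(fscale1 s) -(fscale1 t); exact: FsumRel.
Qed.

Lemma pres_ind (P : pres -> Prop) :
  P 0 -> (forall a b, P a -> P b -> P (a + b)) -> (forall k x, P (pgen k x)) ->
  forall a, P a.
Proof.
move=> P0 PD Pg a; rewrite -(fsum_repr a) fsumE.
by apply: (big_ind P).
Qed.

(* The additive map sending k x to b k x. It is read off a representative,    *)
(* so it is meaningful only when b respects the relations: see plift_gen.     *)
Definition plift (G : zmodType) (b : K -> X -> G) (a : pres) : G :=
  \sum_(p <- repr a) b p.1 p.2.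

Definition respects (G : zmodType) (b : K -> X -> G) : Prop :=
  (forall k l x, b (k + l) x = b k x + b l x) /\
  (forall k s t, R s t ->
     \sum_(p <- s) b (k * p.1) p.2 = \sum_(p <- t) b (k * p.1) p.2).

Section Lift.
Variables (G : zmodType) (b : K -> X -> G).
Hypothesis bR : respects b.

Lemma plift_fsum s : plift b (fsum s) = \sum_(p <- s) b p.1 p.2.
Proof.
have [bD brel] := bR.
have b0 x : b 0 x = 0 by apply: (addrI (b 0 x)); rewrite -bD !addr0.
suff H t u : fsum_eq t u -> \sum_(p <- t) b p.1 p.2 = \sum_(p <- u) b p.1 p.2.
  exact: H (fsum_eq_repr s).
elim=> {s t u} //.
- by move=> s t u _ -> _ ->.
- by move=> s s' t t' _ e1 _ e2; rewrite !big_cat /= e1 e2.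
- by move=> s t; rewrite !big_cat /= addrC.
- by move=> k l x; rewrite !big_cons !big_nil !addr0 bD.
- by move=> x; rewrite big_cons !big_nil /= b0 addr0.
- by move=> k s t Rst; rewrite !big_map /=; exact: brel.
Qed.

Lemma plift_gen k x : plift b (pgen k x) = b k x.
Proof. by rewrite plift_fsum big_seq1. Qed.

Lemma pliftD a c : plift b (a + c) = plift b a + plift b c.
Proof.
rewrite -(fsum_repr a) -(fsum_repr c) -fsumD !plift_fsum.
by rewrite big_cat.
Qed.

Lemma plift0 : plift b 0 = 0.
Proof. by apply: (addrI (plift b 0)); rewrite -pliftD !addr0. Qed.

End Lift.

Lemma eq_plift (G : zmodType) (b b' : K -> X -> G) :
  (forall k x, b k x = b' k x) -> plift b =1 plift b'.
Proof. by move=> e a; apply: eq_bigr => p _; exact: e. Qed.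

Lemma plift_add (G : zmodType) (b b' : K -> X -> G) a :
  plift (fun k x => b k x + b' k x) a = plift b a + plift b' a.
Proof. exact: big_split. Qed.

End PresentedModule.

Arguments plift {K X R G} b a.
Arguments pgen {K X} R k x.

(* For a ring morphism f : R -> S and a left R-module V, the left S-module    *)
(* S (x)_R V, where S is a right R-module through s . r = s * f r.            *)
(* With generators (s, v), closing [balanced] under left multiplication by S  *)
(* yields (s, v + w) = (s, v) + (s, w) and (s, r v) = (s f(r), v).            *)
Section ScalarExtension.
Variables (R S : pzRingType) (f : R -> S) (V : lmodType R).

Inductive balanced : seq (S * V) -> seq (S * V) -> Prop :=
| BalancedAdd v w : balanced [:: (1, v + w)] [:: (1, v); (1, w)]
| BalancedAct r v : balanced [:: (1, r *: v)] [:: (f r, v)].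

Definition scext := pres balanced.
HB.instance Definition _ := GRing.Lmodule.on scext.

Definition stens (s : S) (v : V) : scext := pgen balanced s v.

Definition slift (G : zmodType) (b : S -> V -> G) : scext -> G := plift b.

Definition biadd_balanced (G : zmodType) (b : S -> V -> G) : Prop :=
  [/\ forall s s' v, b (s + s') v = b s v + b s' v,
      forall s v w, b s (v + w) = b s v + b s w &
      forall s r v, b s (r *: v) = b (s * f r) v].

Lemma biadd_respects (G : zmodType) (b : S -> V -> G) :
  biadd_balanced b -> respects balanced b.
Proof.
move=> [b1 b2 b3]; split=> [//|s x y []] => [v w|r v].
  by rewrite !big_cons !big_nil /= !addr0 mulr1 b2.
by rewrite !big_seq1 /= mulr1 b3.
Qed.

Lemma slift_tens (G : zmodType) (b : S -> V -> G) s v :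
  biadd_balanced b -> slift b (stens s v) = b s v.
Proof. by move=> /biadd_respects bR; exact: plift_gen. Qed.

Lemma sliftD (G : zmodType) (b : S -> V -> G) x y :
  biadd_balanced b -> slift b (x + y) = slift b x + slift b y.
Proof. by move=> /biadd_respects bR; exact: pliftD. Qed.

Lemma slift0 (G : zmodType) (b : S -> V -> G) :
  biadd_balanced b -> slift b 0 = 0.
Proof. by move=> /biadd_respects bR; exact: plift0. Qed.

Lemma stens_balanced : biadd_balanced stens.
Proof.
have e s v : stens s v = s *: stens 1 v by rewrite pscale_gen mulr1.
split=> [s s' v|s v w|s r v]; first exact: pgenD.
  rewrite e (e s v) (e s w) -scalerDr; congr (_ *: _).
  by have := pgen_rel (BalancedAdd v w); rewrite !big_cons !big_nil !addr0.
rewrite e (e (s * _)) -scalerA; congr (_ *: _).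
by have := pgen_rel (BalancedAct r v); rewrite !big_seq1 -e.
Qed.

Lemma scale_stens s s' v : s *: stens s' v = stens (s * s') v.
Proof. exact: pscale_gen. Qed.

Lemma scext_ind (P : scext -> Prop) :
  P 0 -> (forall a b, P a -> P b -> P (a + b)) -> (forall s v, P (stens s v)) ->
  forall a, P a.
Proof. exact: pres_ind. Qed.

End ScalarExtension.

Arguments stens {R S} f {V} s v.
Arguments slift {R S f V G} b a.

(* The n-th tensor power of H over F, with factorwise multiplication. It is   *)
(* only a pzRingType: 1 <> 0 in tpow H n is not needed and not established.   *)
Section TensorPower.
Variables (F : fieldType) (H : algType F).

Definition tset n (t : n.-tuple H) (i : 'I_n) (x : H) : n.-tuple H :=
  [tuple if j == i then x else tnth t j | j < n].

Inductive multilin n : seq (F * n.-tuple H) -> seq (F * n.-tuple H) -> Prop :=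
| Multilin t i k x y :
    multilin [:: (1, tset t i (k *: x + y))] [:: (k, tset t i x); (1, tset t i y)].

Definition tpow n := pres (@multilin n).
HB.instance Definition _ n := GRing.Lmodule.on (tpow n).

Definition tpure n (t : n.-tuple H) : tpow n := pgen (@multilin n) 1 t.

Definition tlift n (G : lmodType F) (f : n.-tuple H -> G) : tpow n -> G :=
  plift (fun k t => k *: f t).

Definition multilinear n (G : lmodType F) (f : n.-tuple H -> G) : Prop :=
  forall t i k x y,
    f (tset t i (k *: x + y)) = k *: f (tset t i x) + f (tset t i y).

Section Lift.
Variables (n : nat) (G : lmodType F).
Implicit Types f g : n.-tuple H -> G.

Lemma multilinear_respects f : multilinear f ->
  respects (@multilin n) (fun k t => k *: f t).
Proof.
move=> fM; split=> [k l t|k s t [t' i l x y]]; first exact: scalerDl.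
by rewrite !big_cons !big_nil /= !addr0 mulr1 fM scalerDr scalerA.
Qed.

Lemma tlift_pure f t : multilinear f -> tlift f (tpure t) = f t.
Proof.
by move=> /multilinear_respects fR; rewrite /tlift plift_gen ?scale1r.
Qed.

Lemma tliftD f a b : multilinear f -> tlift f (a + b) = tlift f a + tlift f b.
Proof. by move=> /multilinear_respects fR; exact: pliftD. Qed.

Lemma tlift0 f : multilinear f -> tlift f 0 = 0.
Proof. by move=> /multilinear_respects fR; exact: plift0. Qed.

Lemma tpow_ind (P : tpow n -> Prop) :
  (forall k a b, P a -> P b -> P (k *: a + b)) -> (forall t, P (tpure t)) ->
  P 0 -> forall a, P a.
Proof.
move=> PD Pt P0; apply: pres_ind => // [a b Pa Pb|k t].
  by rewrite -(scale1r a); exact: PD.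
have -> : pgen (@multilin n) k t = k *: tpure t + 0.
  by rewrite addr0 pscale_gen mulr1.
exact: PD.
Qed.

Lemma tlift_linear f : multilinear f -> linear (tlift f).
Proof.
move=> fM k a b; rewrite tliftD //; congr (_ + _).
elim/pres_ind: a => [|a c IHa IHc|l t].
- by rewrite scaler0 tlift0 // scaler0.
- by rewrite scalerDr !tliftD // IHa IHc scalerDr.
- have fR := multilinear_respects fM.
  by rewrite pscale_gen /tlift !plift_gen // scalerA.
Qed.

Lemma eq_tlift f g : f =1 g -> tlift f =1 tlift g.
Proof. by move=> fg; apply: eq_plift => k t; rewrite fg. Qed.

Lemma tlift_comb f g k a :
  tlift (fun t => k *: f t + g t) a = k *: tlift f a + tlift g a.
Proof.
rewrite /tlift /plift scaler_sumr -big_split /=; apply: eq_bigr => p _.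
by rewrite scalerDr !scalerA mulrC.
Qed.

Lemma linear_tlift_eq (g h : tpow n -> G) : linear g -> linear h ->
  (forall t, g (tpure t) = h (tpure t)) -> g =1 h.
Proof.
move=> gL hL gh; apply: tpow_ind => // [k a b ga gb|].
  by rewrite gL hL ga gb.
have e (g' : tpow n -> G) : linear g' -> g' 0 = 0.
  by move=> L; have := L (-1) 0 0; rewrite scaleN1r addNr scaleN1r addNr.
by rewrite !e.
Qed.

Lemma tlift_hom (G' : lmodType F) (h : G -> G') f a : linear h ->
  h (tlift f a) = tlift (fun t => h (f t)) a.
Proof.
move=> hL.
have h0 : h 0 = 0 by have := hL (-1) 0 0; rewrite scaleN1r addNr scaleN1r addNr.
have hD x y : h (x + y) = h x + h y by have := hL 1 x y; rewrite !scale1r.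
rewrite /tlift /plift (big_morph h hD h0); apply: eq_bigr => p _.
by have := hL p.1 (f p.2) 0; rewrite h0 !addr0.
Qed.

End Lift.

Lemma tpure_multilin n : multilinear (@tpure n).
Proof.
move=> t i k x y.
have := pgen_rel (Multilin t i k x y); rewrite !big_cons !big_nil /= !addr0.
by move=> e; rewrite [LHS]e /tpure pscale_gen mulr1.
Qed.

Definition bilift n m (G : lmodType F) (f : n.-tuple H -> m.-tuple H -> G)
  (a : tpow n) (b : tpow m) : G := tlift (fun x => tlift (f x) b) a.

Section BiLift.
Variables (n m : nat) (G : lmodType F) (f : n.-tuple H -> m.-tuple H -> G).
Hypothesis fl : forall y, multilinear (f^~ y).
Hypothesis fr : forall x, multilinear (f x).

Lemma bilift_mulL b : multilinear (fun x => tlift (f x) b).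
Proof.
move=> t i k x y /=; rewrite -tlift_comb; apply: eq_tlift => z; exact: fl.
Qed.

Lemma bilift_linearl b : linear (fun a => bilift f a b).
Proof. by apply: tlift_linear; exact: bilift_mulL. Qed.

Lemma bilift_linearr a : linear (bilift f a).
Proof.
move=> k b c; rewrite /bilift -tlift_comb; apply: eq_tlift => x.
exact: tlift_linear.
Qed.

Lemma bilift_pure x y : bilift f (tpure x) (tpure y) = f x y.
Proof. by rewrite /bilift tlift_pure ?tlift_pure //; exact: bilift_mulL. Qed.

End BiLift.

Definition tuple_mul n (x y : n.-tuple H) : n.-tuple H :=
  [tuple tnth x i * tnth y i | i < n].

Lemma tuple_mul_setl n (x y : n.-tuple H) i a :
  tuple_mul (tset x i a) y = tset (tuple_mul x y) i (a * tnth y i).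
Proof.
apply: eq_from_tnth => j; rewrite !tnth_mktuple.
by case: eqP => [->|].
Qed.

Lemma tuple_mul_setr n (x y : n.-tuple H) i a :
  tuple_mul x (tset y i a) = tset (tuple_mul x y) i (tnth x i * a).
Proof.
apply: eq_from_tnth => j; rewrite !tnth_mktuple.
by case: eqP => [->|].
Qed.

Definition tmul n : tpow n -> tpow n -> tpow n :=
  bilift (fun x y => tpure (tuple_mul x y)).

Lemma tmul_mull n (y : n.-tuple H) : multilinear (fun x => tpure (tuple_mul x y)).
Proof.
by move=> t i k a b; rewrite !tuple_mul_setl mulrDl -scalerAl tpure_multilin.
Qed.

Lemma tmul_mulr n (x : n.-tuple H) : multilinear (fun y => tpure (tuple_mul x y)).
Proof.
by move=> t i k a b; rewrite !tuple_mul_setr mulrDr -scalerAr tpure_multilin.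
Qed.

Lemma tmul_linearl n (b : tpow n) : linear (fun a => tmul a b).
Proof. by apply: bilift_linearl; exact: tmul_mull. Qed.

Lemma tmul_linearr n (a : tpow n) : linear (tmul a).
Proof. by apply: bilift_linearr; exact: tmul_mulr. Qed.

Lemma tmul_pure n (x y : n.-tuple H) :
  tmul (tpure x) (tpure y) = tpure (tuple_mul x y).
Proof. by apply: bilift_pure; [exact: tmul_mull | exact: tmul_mulr]. Qed.

Definition tone n : tpow n := tpure [tuple 1 | i < n].

Lemma tmulA n : associative (@tmul n).
Proof.
move=> a b c.
apply: (linear_tlift_eq (g := fun a => tmul a (tmul b c))
                        (h := fun a => tmul (tmul a b) c)) a => [||x].
- exact: tmul_linearl.
- by move=> k a a'; rewrite !tmul_linearl.
apply: (linear_tlift_eq (g := fun b => tmul (tpure x) (tmul b c))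
                        (h := fun b => tmul (tmul (tpure x) b) c)) b => [||y].
- by move=> k b b'; rewrite tmul_linearl tmul_linearr.
- by move=> k b b'; rewrite tmul_linearr tmul_linearl.
apply: (linear_tlift_eq (g := fun c => tmul (tpure x) (tmul (tpure y) c))
                        (h := fun c => tmul (tmul (tpure x) (tpure y)) c)) c => [||z].
- by move=> k c c'; rewrite !tmul_linearr.
- exact: tmul_linearr.
rewrite !tmul_pure; congr tpure; apply: eq_from_tnth => i.
by rewrite !tnth_mktuple mulrA.
Qed.

Lemma tmul1 n : left_id (tone n) (@tmul n).
Proof.
apply: linear_tlift_eq => [||x] //; first exact: tmul_linearr.
rewrite tmul_pure; congr tpure; apply: eq_from_tnth => i.
by rewrite !tnth_mktuple mul1r.
Qed.

Lemma tmulr1 n : right_id (tone n) (@tmul n).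
Proof.
apply: linear_tlift_eq => [||x] //; first exact: tmul_linearl.
rewrite tmul_pure; congr tpure; apply: eq_from_tnth => i.
by rewrite !tnth_mktuple mulr1.
Qed.

Lemma tmulDl n : left_distributive (@tmul n) +%R.
Proof. by move=> a b c; have := tmul_linearl c 1 a b; rewrite !scale1r. Qed.

Lemma tmulDr n : right_distributive (@tmul n) +%R.
Proof. by move=> a b c; have := tmul_linearr a 1 b c; rewrite !scale1r. Qed.

HB.instance Definition _ n := GRing.Zmodule_isPzRing.Build (tpow n)
  (@tmulA n) (@tmul1 n) (@tmulr1 n) (@tmulDl n) (@tmulDr n).

Lemma tpureM n (x y : n.-tuple H) : tpure x * tpure y = tpure (tuple_mul x y).
Proof. exact: tmul_pure. Qed.

Lemma tscalerAl n k (a b : tpow n) : k *: (a * b) = (k *: a) * b.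
Proof.
have e : tmul 0 b = 0 by exact: mul0r.
by have := tmul_linearl b k a 0; rewrite /= e !addr0 => /esym.
Qed.

Lemma tscalerAr n k (a b : tpow n) : k *: (a * b) = a * (k *: b).
Proof.
have e : tmul a 0 = 0 by exact: mulr0.
by have := tmul_linearr a k b 0; rewrite /= e !addr0 => /esym.
Qed.

(* tcat f g is f (x) g.                                                       *)
Definition tcat n m : tpow n -> tpow m -> tpow (n + m) :=
  bilift (fun x y => tpure (cat_tuple x y)).

Lemma cat_tset_l n m (x : n.-tuple H) (y : m.-tuple H) i a :
  cat_tuple (tset x i a) y = tset (cat_tuple x y) (lshift m i) a.
Proof.
apply: eq_from_tnth => j; rewrite tnth_mktuple.
case: (split_ordP j) => j' ->.
  by rewrite !tnth_lshift tnth_mktuple (inj_eq (@lshift_inj _ _)).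
by rewrite !tnth_rshift eq_rlshift.
Qed.

Lemma cat_tset_r n m (x : n.-tuple H) (y : m.-tuple H) i a :
  cat_tuple x (tset y i a) = tset (cat_tuple x y) (rshift n i) a.
Proof.
apply: eq_from_tnth => j; rewrite tnth_mktuple.
case: (split_ordP j) => j' ->.
  by rewrite !tnth_lshift eq_lrshift.
by rewrite !tnth_rshift tnth_mktuple (inj_eq (@rshift_inj _ _)).
Qed.

Lemma tcat_mull n m (y : m.-tuple H) :
  multilinear (fun x : n.-tuple H => tpure (cat_tuple x y)).
Proof. by move=> t i k a b; rewrite !cat_tset_l tpure_multilin. Qed.

Lemma tcat_mulr n m (x : n.-tuple H) :
  multilinear (fun y : m.-tuple H => tpure (cat_tuple x y)).
Proof. by move=> t i k a b; rewrite !cat_tset_r tpure_multilin. Qed.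

Lemma tcat_linearl n m (b : tpow m) : linear (fun a : tpow n => tcat a b).
Proof. by apply: bilift_linearl; exact: tcat_mull. Qed.

Lemma tcat_linearr n m (a : tpow n) : linear (@tcat n m a).
Proof. by apply: bilift_linearr; exact: tcat_mulr. Qed.

Lemma tcat_pure n m (x : n.-tuple H) (y : m.-tuple H) :
  tcat (tpure x) (tpure y) = tpure (cat_tuple x y).
Proof. by apply: bilift_pure; [exact: tcat_mull | exact: tcat_mulr]. Qed.

(* The linear map H (x) H -> G sending h (x) g to f h g, for f bilinear.      *)
Definition tpair (G : lmodType F) (f : H -> H -> G) : tpow 2 -> G :=
  tlift (fun t : 2.-tuple H => f (tnth t ord0) (tnth t ord_max)).

End TensorPower.

Arguments tpure {F H n} t.

Section TensorPairing.
Variables (F : fieldType) (H : algType F).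

Definition bilin (U V W : lmodType F) (f : U -> V -> W) : Prop :=
  (forall v, linear (f^~ v)) /\ (forall u, linear (f u)).

Lemma lin0 (U V : lmodType F) (f : U -> V) : linear f -> f 0 = 0.
Proof. by move=> L; have := L (-1) 0 0; rewrite scaleN1r addNr scaleN1r addNr. Qed.

Lemma linD (U V : lmodType F) (f : U -> V) x y : linear f -> f (x + y) = f x + f y.
Proof. by move=> L; have := L 1 x y; rewrite !scale1r. Qed.

Lemma linZ (U V : lmodType F) (f : U -> V) k x : linear f -> f (k *: x) = k *: f x.
Proof. by move=> L; have := L k x 0; rewrite (lin0 L) !addr0. Qed.

Lemma linear_comp (U V W : lmodType F) (g : V -> W) (f : U -> V) :
  linear g -> linear f -> linear (fun x => g (f x)).
Proof. by move=> gL fL k x y; rewrite fL gL. Qed.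

Lemma tcat_bilin n m : bilin (@tcat F H n m).
Proof. by split=> x; [exact: tcat_linearl | exact: tcat_linearr]. Qed.

Lemma ord2P (P : 'I_2 -> Prop) : P ord0 -> P ord_max -> forall i, P i.
Proof.
move=> P0 P1 [[|[|//]] i2].
  by rewrite (_ : Ordinal i2 = ord0) //; exact: val_inj.
by rewrite (_ : Ordinal i2 = ord_max) //; exact: val_inj.
Qed.

Section Pair.
Variables (G : lmodType F) (f : H -> H -> G).
Hypothesis fB : bilin f.

Lemma tpair_multilinear :
  multilinear (fun t : 2.-tuple H => f (tnth t ord0) (tnth t ord_max)).
Proof.
have [fl fr] := fB.
move=> t; apply: ord2P => k x y; rewrite !tnth_mktuple /=.
  exact: fl.
exact: fr.
Qed.

Lemma tpair_linear : linear (tpair f).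
Proof. by apply: tlift_linear; exact: tpair_multilinear. Qed.

Lemma tpair_pure (x y : H) : tpair f (tpure [tuple x; y]) = f x y.
Proof. by rewrite /tpair tlift_pure //; exact: tpair_multilinear. Qed.

End Pair.

Lemma eq_tpair (G : lmodType F) (f g : H -> H -> G) :
  (forall x y, f x y = g x y) -> tpair f =1 tpair g.
Proof. by move=> fg; apply: eq_tlift => t; exact: fg. Qed.

Lemma tpair_hom (G G' : lmodType F) (h : G -> G') (f : H -> H -> G) p :
  linear h -> h (tpair f p) = tpair (fun x y => h (f x y)) p.
Proof. exact: tlift_hom. Qed.

Lemma tuple1_eta (t : 1.-tuple H) : t = [tuple tnth t ord0].
Proof. by apply: eq_from_tnth => i; rewrite ord1. Qed.

Lemma tuple2_eta (t : 2.-tuple H) : t = [tuple tnth t ord0; tnth t ord_max].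
Proof. by apply: eq_from_tnth; exact: ord2P. Qed.

Lemma tpow2_eq (G : lmodType F) (f g : tpow H 2 -> G) : linear f -> linear g ->
  (forall x y, f (tpure [tuple x; y]) = g (tpure [tuple x; y])) -> f =1 g.
Proof.
by move=> fL gL fg; apply: linear_tlift_eq => // t; rewrite (tuple2_eta t).
Qed.

Lemma tpure1_linear : linear (fun x : H => tpure [tuple x]).
Proof.
move=> k x y; have := @tpure_multilin _ H 1 [tuple 0] ord0 k x y.
have e z : tset [tuple 0] ord0 z = [tuple z].
  by apply: eq_from_tnth => i; rewrite tnth_mktuple !(ord1 i).
by rewrite !e.
Qed.

Lemma tcatM n m (a c : tpow H n) (b d : tpow H m) :
  tcat a b * tcat c d = tcat (a * c) (b * d).
Proof.
have lm l (z : tpow H l) : linear (fun x : tpow H l => x * z : tpow H l) by exact: tmul_linearl.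
have rm l (z : tpow H l) : linear (fun x : tpow H l => z * x : tpow H l) by exact: tmul_linearr.
have lc y : linear (fun x => @tcat _ H n m x y) by exact: tcat_linearl.
have rc x : linear (fun y => @tcat _ H n m x y) by exact: tcat_linearr.
move: a; apply: linear_tlift_eq => [||x].
- exact: (linear_comp (lm _ _) (lc b)).
- exact: (linear_comp (lc _) (lm _ c)).
move: b; apply: linear_tlift_eq => [||y].
- exact: (linear_comp (lm _ _) (rc _)).
- exact: (linear_comp (rc _) (lm _ d)).
move: c; apply: linear_tlift_eq => [||x'].
- exact: (linear_comp (rm _ _) (lc d)).
- exact: (linear_comp (lc _) (rm _ _)).
move: d; apply: linear_tlift_eq => [||y'].
- exact: (linear_comp (rm _ _) (rc _)).
- exact: (linear_comp (rc _) (rm _ _)).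
rewrite !tcat_pure !tpureM tcat_pure; congr tpure.
apply: eq_from_tnth => i; rewrite tnth_mktuple.
by case: (split_ordP i) => j ->; rewrite ?tnth_lshift ?tnth_rshift tnth_mktuple.
Qed.

Lemma ecast_linear n m (e : n = m) : linear (fun x : tpow H n => ecast k (tpow H k) e x).
Proof. by case: _ / e. Qed.

Lemma tpure_ecast n m (e : n = m) (t : n.-tuple H) :
  ecast k (tpow H k) e (tpure t) = tpure (ecast k (k.-tuple H) e t).
Proof. by case: _ / e. Qed.

Lemma val_ecast n m (e : n = m) (t : n.-tuple H) :
  val (ecast k (k.-tuple H) e t) = val t.
Proof. by case: _ / e. Qed.

Lemma tcatA n m l (a : tpow H n) (b : tpow H m) (c : tpow H l)
    (e : (n + m + l = n + (m + l))%N) :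
  tcat a (tcat b c) = ecast k (tpow H k) e (tcat (tcat a b) c).
Proof.
have lc n' m' y : linear (fun x => @tcat _ H n' m' x y) by exact: tcat_linearl.
have rc n' m' x : linear (fun y => @tcat _ H n' m' x y) by exact: tcat_linearr.
have ce := ecast_linear e.
move: a; apply: linear_tlift_eq => [||x].
- exact: lc.
- exact: (linear_comp ce (linear_comp (lc _ _ _) (lc _ _ _))).
move: b; apply: linear_tlift_eq => [||y].
- exact: (linear_comp (rc _ _ _) (lc _ _ _)).
- exact: (linear_comp ce (linear_comp (lc _ _ _) (rc _ _ _))).
move: c; apply: linear_tlift_eq => [||z].
- exact: (linear_comp (rc _ _ _) (rc _ _ _)).
- exact: (linear_comp ce (rc _ _ _)).
rewrite !tcat_pure.
rewrite tpure_ecast; congr tpure; apply: val_inj.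
by rewrite val_ecast /= catA.
Qed.

Lemma tcat0l n (a : tpow H n) : tcat (tpure [tuple]) a = a.
Proof.
move: a; apply: linear_tlift_eq => // [|t]; first exact: tcat_linearr.
by rewrite tcat_pure; congr tpure; exact: val_inj.
Qed.

End TensorPairing.

HB.mixin Record isHopfAlgebra (F : fieldType) H of GRing.Algebra F H := {
  comul : H -> tpow H 2;
  counit : H -> F;
  antipode : H -> H;
  comul_linear : linear comul;
  comul_monoid : monoid_morphism comul;
  counit_linear : scalar counit;
  counit_monoid : monoid_morphism counit;
  antipode_linear : linear antipode;
  comulA : forall h,
    tpair (fun x y => tcat (comul x) (tpure [tuple y])) (comul h)
    = tpair (fun x y => tcat (tpure [tuple x]) (comul y)) (comul h) :> tpow H 3;
  counitl : forall h, tpair (fun x y => counit x *: y) (comul h) = h;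
  counitr : forall h, tpair (fun x y => counit y *: x) (comul h) = h;
  antipodel : forall h,
    tpair (fun x y => antipode x * y) (comul h) = (counit h)%:A;
  antipoder : forall h,
    tpair (fun x y => x * antipode y) (comul h) = (counit h)%:A
}.

#[short(type="hopfAlgType")]
HB.structure Definition HopfAlgebra (F : fieldType) :=
  {H of isHopfAlgebra F H & GRing.Algebra F H}.

Section HopfTheory.
Variables (F : fieldType) (H : hopfAlgType F).

(* iterD n.+1 is the iterated comultiplication Delta^(n) : H -> H^(n+1), and  *)
(* iterD 0 is the counit.                                                     *)
Fixpoint iterD n : H -> tpow H n :=
  match n return H -> tpow H n with
  | 0 => fun h => counit h *: tpure [tuple]
  | m.+1 =>
    match m return (H -> tpow H m) -> H -> tpow H m.+1 with
    | 0 => fun _ h => tpure [tuple h]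
    | _.+1 => fun D h =>
        tpair (fun x y => tcat (tpure [tuple x]) (D y)) (comul h)
    end (iterD m)
  end.

(* Delta^(n-1) (x) Delta^(m-1).                                               *)
Definition iterD2 n m : tpow H 2 -> tpow H (n + m) :=
  tpair (fun x y => tcat (iterD n x) (iterD m y)).

(* H^n (x)_H V, where H acts on H^n on the right by p . h = p * iterD n h; it *)
(* is a left H^n-module by multiplication on the first factor.                *)
Definition hten n (V : lmodType H) := scext (@iterD n) V.
HB.instance Definition _ n V := GRing.Lmodule.on (hten n V).

Definition htens n (V : lmodType H) (f : tpow H n) (v : V) : hten n V :=
  stens (@iterD n) f v.

Definition hlift n (V : lmodType H) (G : zmodType) (b : tpow H n -> V -> G) :
  hten n V -> G := slift b.

(* id (x)_H f.                                                                *)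
Definition hmap n (V W : lmodType H) (f : V -> W) : hten n V -> hten n W :=
  hlift (fun p v => htens p (f v)).

(* The map H^n (x)_H V -> V sending p (x)_H v to (f p) v.                     *)
Definition hcontract n (V : lmodType H) (f : tpow H n -> H) : hten n V -> V :=
  hlift (fun p v => f p *: v).

Definition id_counit : tpow H 2 -> H := tpair (fun h k => counit k *: h).
Definition counit_id : tpow H 2 -> H := tpair (fun h k => counit h *: k).

(* H^2-linear maps V1 (x) V2 -> H^2 (x)_H V3, in curried form; F-bilinearity  *)
(* is the case h = a%:A, g = b%:A of the last condition.                      *)
Definition H2linear (V1 V2 V3 : lmodType H) (op : V1 -> V2 -> hten 2 V3) : Prop :=
  [/\ forall v v' w, op (v + v') w = op v w + op v' w,
      forall v w w', op v (w + w') = op v w + op v w' &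
      forall h g v w, op (h *: v) (g *: w) = tpure [tuple h; g] *: op v w].

(* The composition rule for an H^2-linear op; pext_tens is its defining       *)
(* formula.                                                                   *)
Definition pext (V1 V2 V3 : lmodType H) (op : V1 -> V2 -> hten 2 V3) n m
    (a : hten n V1) (b : hten m V2) : hten (n + m) V3 :=
  hlift (fun f v => hlift (fun g w =>
    hlift (fun p u => htens (tcat f g * iterD2 n m p) u) (op v w)) b) a.

(* V is identified with H (x)_H V.                                            *)
Definition hunit (V : lmodType H) (v : V) : hten 1 V := htens 1 v.

(* op' (op a b) c and op' a (op b c) in H^3 (x)_H V.                          *)
Definition pcompl (V1 V2 V3 V W : lmodType H) (op' : W -> V3 -> hten 2 V)
    (op : V1 -> V2 -> hten 2 W) (a : V1) (b : V2) (c : V3) : hten 3 V :=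
  pext op' (op a b) (hunit c).

Definition pcompr (V1 V2 V3 V W : lmodType H) (op' : V1 -> W -> hten 2 V)
    (op : V2 -> V3 -> hten 2 W) (a : V1) (b : V2) (c : V3) : hten 3 V :=
  pext op' (hunit a) (op b c).

End HopfTheory.


Section HopfLemmas.
Variables (F : fieldType) (H : hopfAlgType F).

Lemma iterD_linear n : linear (@iterD F H n).
Proof.
elim: n => [|[|n] IHn].
- by move=> k x y /=; rewrite counit_linear scalerDl scalerA.
- exact: tpure1_linear.
- apply: linear_comp (@comul_linear F H); apply: tpair_linear.
  split=> [y|x]; first exact: (linear_comp (tcat_linearl (iterD n.+1 y)) (@tpure1_linear F H)).
  exact: (linear_comp (tcat_linearr (tpure [tuple x])) IHn).
Qed.

Lemma iterD2_bilin n m : bilin (fun x y : H => tcat (iterD n x) (iterD m y)).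
Proof.
split=> [y|x]; first exact: (linear_comp (tcat_linearl (iterD m y)) (iterD_linear n)).
exact: (linear_comp (tcat_linearr (iterD n x)) (iterD_linear m)).
Qed.

Lemma iterD2_linear n m : linear (@iterD2 F H n m).
Proof. by apply: tpair_linear; exact: iterD2_bilin. Qed.

Lemma iterD2_pure n m (x y : H) :
  iterD2 n m (tpure [tuple x; y]) = tcat (iterD n x) (iterD m y).
Proof. by apply: tpair_pure; exact: iterD2_bilin. Qed.

Lemma iterDSS n (h : H) : iterD n.+2 h = iterD2 1 n.+1 (comul h).
Proof. by []. Qed.

Lemma tmul1E n : (1 : tpow H n) = tpure [tuple 1 | i < n].
Proof. by []. Qed.

Lemma iterD2_monoid n m : monoid_morphism (@iterD F H n) ->
  monoid_morphism (@iterD F H m) -> monoid_morphism (@iterD2 F H n m).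
Proof.
move=> [n1 nM] [m1 mM]; split.
  rewrite tmul1E (tuple2_eta [tuple 1 | i < 2]) !tnth_mktuple iterD2_pure n1 m1.
  rewrite !tmul1E tcat_pure; congr tpure; apply: eq_from_tnth => i.
  by case: (split_ordP i) => j ->; rewrite ?tnth_lshift ?tnth_rshift !tnth_mktuple.
move=> p q.
move: p; apply: tpow2_eq => [||x y].
- exact: linear_comp (@iterD2_linear n m) (@tmul_linearl _ _ _ q).
- exact: linear_comp (@tmul_linearl _ _ _ _) (@iterD2_linear n m).
move: q; apply: tpow2_eq => [||x' y'].
- exact: linear_comp (@iterD2_linear n m) (@tmul_linearr _ _ _ _).
- exact: linear_comp (@tmul_linearr _ _ _ _) (@iterD2_linear n m).
rewrite tpureM (tuple2_eta (tuple_mul _ _)) !tnth_mktuple !iterD2_pure.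
by rewrite tcatM -nM -mM.
Qed.

Lemma iterD_monoid n : monoid_morphism (@iterD F H n).
Proof.
elim: n => [|[|n] IHn].
- have [c1 cM] := @counit_monoid F H.
  have t0 (t : 0.-tuple H) : t = [tuple] by rewrite tuple0.
  split=> [|x y] /=.
    by rewrite c1 scale1r tmul1E; congr tpure; rewrite (t0 (mktuple _)).
  rewrite cM -tscalerAl -tscalerAr scalerA tpureM.
  by rewrite (t0 (tuple_mul _ _)).
- split=> [|x y] /=; rewrite ?tmul1E ?tpureM; congr tpure.
    by apply: eq_from_tnth => i; rewrite ord1 tnth_mktuple.
  by apply: eq_from_tnth => i; rewrite ord1 tnth_mktuple.
- have I1 : monoid_morphism (@iterD F H 1).
    split=> [|x y] /=; rewrite ?tmul1E ?tpureM; congr tpure.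
      by apply: eq_from_tnth => i; rewrite ord1 tnth_mktuple.
    by apply: eq_from_tnth => i; rewrite ord1 tnth_mktuple.
  have [d1 dM] := iterD2_monoid I1 IHn; have [c1 cM] := @comul_monoid F H.
  by split=> [|x y]; rewrite !iterDSS ?c1 ?cM ?d1 ?dM.
Qed.

Definition tri3 (n m l : nat) : tpow H 3 -> tpow H (n + m + l) :=
  tlift (fun t : 3.-tuple H =>
    tcat (tcat (iterD n (tnth t (inord 0))) (iterD m (tnth t (inord 1))))
         (iterD l (tnth t (inord 2)))).

Lemma ord3P (P : 'I_3 -> Prop) :
  P (inord 0) -> P (inord 1) -> P (inord 2) -> forall i, P i.
Proof.
move=> P0 P1 P2 [[|[|[|//]]] i3].
- by rewrite (_ : Ordinal i3 = inord 0) //; apply: val_inj; rewrite /= inordK.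
- by rewrite (_ : Ordinal i3 = inord 1) //; apply: val_inj; rewrite /= inordK.
- by rewrite (_ : Ordinal i3 = inord 2) //; apply: val_inj; rewrite /= inordK.
Qed.

Lemma tri3_multilinear n m l : multilinear (fun t : 3.-tuple H =>
    tcat (tcat (iterD n (tnth t (inord 0))) (iterD m (tnth t (inord 1))))
         (iterD l (tnth t (inord 2)))).
Proof.
have ne (i j : nat) : (i < 3)%N -> (j < 3)%N ->
    (inord i == inord j :> 'I_3) = (i == j).
  by move=> i3 j3; rewrite -val_eqE /= !inordK.
move=> t; apply: ord3P => k x y; rewrite !tnth_mktuple !ne //=.
- by rewrite iterD_linear !tcat_linearl.
- by rewrite iterD_linear tcat_linearr tcat_linearl.
- by rewrite iterD_linear tcat_linearr.
Qed.

Lemma tri3_linear n m l : linear (@tri3 n m l).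
Proof. by apply: tlift_linear; exact: tri3_multilinear. Qed.

Lemma tri3_pure n m l (x y z : H) : tri3 n m l (tpure [tuple x; y; z])
  = tcat (tcat (iterD n x) (iterD m y)) (iterD l z).
Proof.
rewrite /tri3 tlift_pure; last exact: tri3_multilinear.
by rewrite !(tnth_nth 0) !inordK.
Qed.

Lemma tri3_catl n m l (p : tpow H 2) (z : H) :
  tri3 n m l (tcat p (tpure [tuple z])) = tcat (iterD2 n m p) (iterD l z).
Proof.
move: p; apply: tpow2_eq => [||x y].
- exact: (linear_comp (@tri3_linear n m l) (@tcat_linearl F H 2 1 (tpure [tuple z]))).
- exact: (linear_comp (tcat_linearl (iterD l z)) (@iterD2_linear n m)).
rewrite tcat_pure iterD2_pure -tri3_pure; congr (tri3 _ _ _ (tpure _)).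
exact: val_inj.
Qed.

Lemma tri3_catr n m l (x : H) (p : tpow H 2) :
  tri3 n m l (tcat (tpure [tuple x]) p)
  = ecast k (tpow H k) (addnA n m l) (tcat (iterD n x) (iterD2 m l p)).
Proof.
have ce := @ecast_linear F H _ _ (addnA n m l).
move: p; apply: tpow2_eq => [||y z].
- exact: (linear_comp (@tri3_linear n m l) (@tcat_linearr F H 1 2 (tpure [tuple x]))).
- exact: (linear_comp ce (linear_comp (tcat_linearr (iterD n x)) (@iterD2_linear m l))).
rewrite tcat_pure iterD2_pure (tcatA _ _ _ (esym (addnA n m l))).
have -> k k' (e : k = k') (a : tpow H k') :
  ecast k (tpow H k) e (ecast k (tpow H k) (esym e) a) = a by case: _ / e a.
by rewrite -tri3_pure; congr (tri3 _ _ _ (tpure _)); exact: val_inj.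
Qed.

Lemma iterD2_comul n m (h : H) : iterD2 n m (comul h) = iterD (n + m) h.
Proof.
elim: n m h => [|[|n] IHn] m h.
- rewrite /iterD2 -[in RHS](counitl h) (tpair_hom _ _ (@iterD_linear m)).
  apply: eq_tpair => x y.
  by rewrite (linZ _ _ (@iterD_linear m)) (linZ _ _ (tcat_linearl _)) tcat0l.
- case: m => [|m] //.
  rewrite -[in RHS](counitr h) /iterD2 (tpair_hom _ _ (@iterD_linear 1)).
  apply: eq_tpair => x y.
  rewrite (linZ _ _ (@iterD_linear 1)) [LHS](linZ _ _ (tcat_linearr _)).
  by congr (_ *: _); rewrite /= tcat_pure; congr tpure; exact: val_inj.
- have := congr1 (@tri3 1 n.+1 m) (comulA h).
  rewrite !(tpair_hom _ _ (@tri3_linear 1 n.+1 m)) => e.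
  transitivity (tpair (fun x y => tri3 1 n.+1 m (tcat (comul x) (tpure [tuple y])))
                  (comul h)).
    by apply: eq_tpair => x y; rewrite tri3_catl.
  rewrite [LHS]e; apply: eq_tpair => x y.
  rewrite tri3_catr IHn; move: (addnA 1 n.+1 m) => e0.
  by rewrite (eq_axiomK e0).
Qed.

Lemma iterD2E (h : H) : iterD 2 h = comul h.
Proof.
rewrite -[LHS]/(iterD2 1 1 (comul h)); move: (comul h).
apply: (tpow2_eq (f := @iterD2 F H 1 1 : tpow H 2 -> tpow H 2) (g := id)) => //.
  exact: (@iterD2_linear 1 1).
move=> x y; rewrite iterD2_pure /= tcat_pure; congr tpure; exact: val_inj.
Qed.


Lemma htens_balanced n (V : lmodType H) : biadd_balanced (@iterD F H n) (@htens F H n V).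
Proof. exact: stens_balanced. Qed.

Lemma hlift_tens n (V : lmodType H) (G : zmodType) (b : tpow H n -> V -> G) p v :
  biadd_balanced (@iterD F H n) b -> hlift b (htens p v) = b p v.
Proof. exact: slift_tens. Qed.

Lemma hten_ind n (V : lmodType H) (P : hten n V -> Prop) :
  P 0 -> (forall a b, P a -> P b -> P (a + b)) -> (forall p v, P (htens p v)) ->
  forall a, P a.
Proof. exact: scext_ind. Qed.

Lemma scale_htens n (V : lmodType H) (p q : tpow H n) (v : V) :
  p *: htens q v = htens (p * q) v.
Proof. exact: scale_stens. Qed.

Lemma hmap_balanced n (V W : lmodType H) (f : V -> W) : linear f ->
  biadd_balanced (@iterD F H n) (fun p v => htens p (f v)).
Proof.
move=> fL; have [b1 b2 b3] := @htens_balanced n W.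
have fD v w : f (v + w) = f v + f w by have := fL 1 v w; rewrite !scale1r.
have f0 : f 0 = 0 by apply: (addrI (f 0)); rewrite -fD !addr0.
have fZ h v : f (h *: v) = h *: f v by have := fL h v 0; rewrite f0 !addr0.
by split=> [p q v|p v w|p h v]; rewrite ?fD ?fZ.
Qed.

Lemma hmap_tens n (V W : lmodType H) (f : V -> W) (p : tpow H n) v : linear f ->
  hmap f (htens p v) = htens p (f v).
Proof. by move=> fL; rewrite /hmap hlift_tens //; exact: hmap_balanced. Qed.

Lemma id_counitE (x y : H) : id_counit (tpure [tuple x; y]) = counit y *: x.
Proof.
rewrite /id_counit tpair_pure //; split=> [v|u] k a b; first by rewrite scalerDr !scalerA mulrC.
by rewrite counit_linear scalerDl scalerA.
Qed.

Lemma counit_idE (x y : H) : counit_id (tpure [tuple x; y]) = counit x *: y.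
Proof.
rewrite /counit_id tpair_pure //; split=> [v|u] k a b; last by rewrite scalerDr !scalerA mulrC.
by rewrite counit_linear scalerDl scalerA.
Qed.

Lemma id_counit_linear : linear (@id_counit F H).
Proof.
apply: tpair_linear; split=> [v|u] k a b; first by rewrite scalerDr !scalerA mulrC.
by rewrite counit_linear scalerDl scalerA.
Qed.

Lemma counit_id_linear : linear (@counit_id F H).
Proof.
apply: tpair_linear; split=> [v|u] k a b; last by rewrite scalerDr !scalerA mulrC.
by rewrite counit_linear scalerDl scalerA.
Qed.

Lemma mull_linear (z : H) : linear (fun x : H => x * z).
Proof. by move=> k x y; rewrite mulrDl scalerAl. Qed.

Lemma mulr_linear (z : H) : linear (fun x : H => z * x).
Proof. by move=> k x y; rewrite mulrDr scalerAr. Qed.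

Lemma id_counitM (p q : tpow H 2) : id_counit (p * q) = id_counit p * id_counit q.
Proof.
have [_ eM] := @counit_monoid F H.
move: p; apply: tpow2_eq => [||x y].
- exact: (linear_comp id_counit_linear (@tmul_linearl _ _ _ q)).
- exact: (linear_comp (mull_linear (id_counit q)) id_counit_linear).
move: q; apply: tpow2_eq => [||x' y'].
- exact: (linear_comp id_counit_linear (@tmul_linearr _ _ _ (tpure [tuple x; y]))).
- exact: (linear_comp (mulr_linear _) id_counit_linear).
rewrite tpureM (tuple2_eta (tuple_mul _ _)) !tnth_mktuple !id_counitE /=.
by rewrite eM -scalerAl -scalerAr scalerA.
Qed.

Lemma counit_idM (p q : tpow H 2) : counit_id (p * q) = counit_id p * counit_id q.
Proof.
have [_ eM] := @counit_monoid F H.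
move: p; apply: tpow2_eq => [||x y].
- exact: (linear_comp counit_id_linear (@tmul_linearl _ _ _ q)).
- exact: (linear_comp (mull_linear (counit_id q)) counit_id_linear).
move: q; apply: tpow2_eq => [||x' y'].
- exact: (linear_comp counit_id_linear (@tmul_linearr _ _ _ (tpure [tuple x; y]))).
- exact: (linear_comp (mulr_linear _) counit_id_linear).
rewrite tpureM (tuple2_eta (tuple_mul _ _)) !tnth_mktuple !counit_idE /=.
by rewrite eM -scalerAl -scalerAr scalerA.
Qed.

Lemma id_counit_balanced (V : lmodType H) :
  biadd_balanced (@iterD F H 2) (fun p (v : V) => id_counit p *: v).
Proof.
split=> [p q v|p v w|p h v]; first by rewrite (linD _ _ id_counit_linear) scalerDl.
  exact: scalerDr.
by rewrite iterD2E id_counitM scalerA [id_counit (comul h)]counitr.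
Qed.

Lemma counit_id_balanced (V : lmodType H) :
  biadd_balanced (@iterD F H 2) (fun p (v : V) => counit_id p *: v).
Proof.
split=> [p q v|p v w|p h v]; first by rewrite (linD _ _ counit_id_linear) scalerDl.
  exact: scalerDr.
by rewrite iterD2E counit_idM scalerA [counit_id (comul h)]counitl.
Qed.

Lemma hcontract_id_counit (V : lmodType H) (p : tpow H 2) (v : V) :
  hcontract (@id_counit F H) (htens p v) = id_counit p *: v.
Proof. by rewrite /hcontract hlift_tens //; exact: id_counit_balanced. Qed.

Lemma hcontract_counit_id (V : lmodType H) (p : tpow H 2) (v : V) :
  hcontract (@counit_id F H) (htens p v) = counit_id p *: v.
Proof. by rewrite /hcontract hlift_tens //; exact: counit_id_balanced. Qed.

Section Extension.
Variables (V1 V2 V3 : lmodType H) (op : V1 -> V2 -> hten 2 V3).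
Hypothesis opL : H2linear op.
Variables n m : nat.

Let inner3 (f : tpow H n) (g : tpow H m) (p : tpow H 2) (u : V3) : hten (n + m) V3 :=
  htens (tcat f g * iterD2 n m p) u.

Lemma pext_balanced3 f g : biadd_balanced (@iterD F H 2) (inner3 f g).
Proof.
have [b1 b2 b3] := @htens_balanced (n + m) V3.
have [_ dM] := iterD2_monoid (@iterD_monoid n) (@iterD_monoid m).
rewrite /inner3; split=> [p q v|p v w|p h v]; last 2 first.
- exact: b2.
- by rewrite b3 iterD2E dM iterD2_comul mulrA.
by rewrite (linD _ _ (@iterD2_linear n m)) mulrDr b1.
Qed.

Lemma hlift_additive k (V : lmodType H) (G : zmodType) (b : tpow H k -> V -> G) :
  biadd_balanced (@iterD F H k) b ->
  hlift b 0 = 0 /\ (forall x y, hlift b (x + y) = hlift b x + hlift b y).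
Proof.
move=> bB; split=> [|x y].
  exact: (slift0 bB).
exact: (sliftD _ _ bB).
Qed.

Lemma hlift_add_fun k (V : lmodType H) (G : zmodType) (b b' : tpow H k -> V -> G) x :
  hlift (fun p v => b p v + b' p v) x = hlift b x + hlift b' x.
Proof. exact: plift_add. Qed.

Lemma eq_hlift k (V : lmodType H) (G : zmodType) (b b' : tpow H k -> V -> G) :
  (forall p v, b p v = b' p v) -> hlift b =1 hlift b'.
Proof. exact: eq_plift. Qed.

Lemma pext_scale f g h h' (x : hten 2 V3) :
  hlift (inner3 f g) (tpure [tuple h; h'] *: x) =
  hlift (inner3 (f * iterD n h) (g * iterD m h')) x.
Proof.
have [_ dM] := iterD2_monoid (@iterD_monoid n) (@iterD_monoid m).
have [z0 zD] := hlift_additive (pext_balanced3 f g).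
have [z0' zD'] := hlift_additive (pext_balanced3 (f * iterD n h) (g * iterD m h')).
elim/hten_ind: x => [|a b IHa IHb|p v].
- by rewrite scaler0 z0 z0'.
- by rewrite scalerDr zD zD' IHa IHb.
rewrite scale_htens !hlift_tens; try exact: pext_balanced3.
by rewrite /inner3 dM iterD2_pure mulrA tcatM.
Qed.

Lemma pext_balanced2 f v :
  biadd_balanced (@iterD F H m) (fun g w => hlift (inner3 f g) (op v w)).
Proof.
have [opDl opDr opS] := opL; have [b1 _ _] := @htens_balanced (n + m) V3.
split=> [g g' w|g w w'|g h w].
- rewrite -hlift_add_fun; apply: eq_hlift => p u.
  by rewrite /inner3 (linD _ _ (tcat_linearr f)) mulrDl b1.
- by rewrite opDr; have [_ ->] := hlift_additive (pext_balanced3 f g).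
- rewrite -[v in LHS]scale1r opS pext_scale.
  by have [-> _] := @iterD_monoid n; rewrite mulr1.
Qed.

Lemma pext_balanced1 b : biadd_balanced (@iterD F H n)
  (fun f v => hlift (fun g w => hlift (inner3 f g) (op v w)) b).
Proof.
have [opDl opDr opS] := opL; have [b1 _ _] := @htens_balanced (n + m) V3.
split=> [f f' v|f v v'|f h v].
- rewrite -hlift_add_fun; apply: eq_hlift => g w.
  rewrite -hlift_add_fun; apply: eq_hlift => p u.
  by rewrite /inner3 (linD _ _ (tcat_linearl g)) mulrDl b1.
- rewrite -hlift_add_fun; apply: eq_hlift => g w.
  by rewrite opDl; have [_ ->] := hlift_additive (pext_balanced3 f g).
- apply: eq_hlift => g w.
  rewrite -[w in LHS]scale1r opS pext_scale.
  by have [-> _] := @iterD_monoid m; rewrite mulr1.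
Qed.

Lemma pextDl (a a' : hten n V1) (b : hten m V2) :
  pext op (a + a') b = pext op a b + pext op a' b.
Proof. by have [_ zD] := hlift_additive (pext_balanced1 b); exact: zD. Qed.

Lemma pextDr (a : hten n V1) (b b' : hten m V2) :
  pext op a (b + b') = pext op a b + pext op a b'.
Proof.
rewrite -hlift_add_fun; apply: eq_hlift => f v.
by have [_ zD] := hlift_additive (pext_balanced2 f v); exact: zD.
Qed.

Lemma pext_tens (f : tpow H n) v (g : tpow H m) w :
  pext op (htens f v) (htens g w) =
  hlift (fun p u => htens (tcat f g * iterD2 n m p) u) (op v w).
Proof.
rewrite /pext hlift_tens; last exact: pext_balanced1.
by rewrite hlift_tens //; exact: pext_balanced2.
Qed.

End Extension.

End HopfLemmas.

HB.mixin Record isPseudoAlgebra (F : fieldType) (H : hopfAlgType F) A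
    of GRing.Lmodule H A := {
  pmul : A -> A -> hten 2 A;
  pmul_H2linear : H2linear pmul;
  pmulA : forall a b c, pcompl pmul pmul a b c = pcompr pmul pmul a b c
}.

#[short(type="pseudoAlgType")]
HB.structure Definition PseudoAlgebra (F : fieldType) (H : hopfAlgType F) :=
  {A of isPseudoAlgebra F H A & GRing.Lmodule H A}.

HB.mixin Record isPseudoBimodule (F : fieldType) (H : hopfAlgType F)
    (A : pseudoAlgType H) M of GRing.Lmodule H M := {
  lact : A -> M -> hten 2 M;
  ract : M -> A -> hten 2 M;
  lact_H2linear : H2linear lact;
  ract_H2linear : H2linear ract;
  lactA : forall a b u, pcompl lact pmul a b u = pcompr lact lact a b u;
  ractA : forall u a b, pcompl ract ract u a b = pcompr ract pmul u a b;
  lractA : forall a u b, pcompl ract lact a u b = pcompr lact ract a u b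
}.

#[short(type="pseudoBimodType")]
HB.structure Definition PseudoBimodule (F : fieldType) (H : hopfAlgType F)
    (A : pseudoAlgType H) :=
  {M of isPseudoBimodule F H A M & GRing.Lmodule H M}.

Section Hochschild.
Variables (F : fieldType) (H : hopfAlgType F) (A : pseudoAlgType H).
Variable M : pseudoBimodType A.

Definition is_derivation (f : A -> M) : Prop :=
  linear f /\ forall a b, hmap f (pmul a b) = lact a (f b) + ract (f a) b.

Definition inner (u : M) (a : A) : M :=
  hcontract (@id_counit _ H) (lact a u) - hcontract (@counit_id _ H) (ract u a).

(* F (x)_H M, with F a right H-module through the counit.                     *)
Definition cochain0 := scext (@counit F H) M.

Definition class0 (u : M) : cochain0 := stens (@counit F H) 1 u.

Definition is_cochain1 (phi : A -> M) : Prop := linear phi.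

Definition is_cochain2 (psi : A -> A -> hten 2 M) : Prop := H2linear psi.

(* F acts on the H-module M by k u = k%:A *: u; see d0_class for the value    *)
(* on the class of u.                                                         *)
Definition d0 (c : cochain0) (a : A) : M :=
  slift (fun k u => k%:A *: inner u a) c.

Definition d1 (phi : A -> M) (a b : A) : hten 2 M :=
  lact a (phi b) - hmap phi (pmul a b) + ract (phi a) b.

End Hochschild.

Section HochschildLemmas.
Variables (F : fieldType) (H : hopfAlgType F) (A : pseudoAlgType H).
Variable M : pseudoBimodType A.

Let bic := @id_counit_balanced F H M.
Let bci := @counit_id_balanced F H M.

Lemma hcontract_id_counitZ h g (x : hten 2 M) :
  hcontract (@id_counit F H) (tpure [tuple h; g] *: x) =
  (counit g)%:A *: (h *: hcontract (@id_counit F H) x).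
Proof.
have [z0 zD] := hlift_additive bic.
elim/hten_ind: x => [|a b IHa IHb|p v].
- by rewrite scaler0 [hcontract _ 0]z0 !scaler0.
- by rewrite scalerDr [LHS]zD [hcontract _ (a + b)]zD !scalerDr -IHa -IHb.
by rewrite scale_htens !hcontract_id_counit id_counitM id_counitE !scalerA mulr_algl -!scalerAl.
Qed.

Lemma hcontract_counit_idZ h g (x : hten 2 M) :
  hcontract (@counit_id F H) (tpure [tuple h; g] *: x) =
  (counit h)%:A *: (g *: hcontract (@counit_id F H) x).
Proof.
have [z0 zD] := hlift_additive bci.
elim/hten_ind: x => [|a b IHa IHb|p v].
- by rewrite scaler0 [hcontract _ 0]z0 !scaler0.
- by rewrite scalerDr [LHS]zD [hcontract _ (a + b)]zD !scalerDr -IHa -IHb.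
by rewrite scale_htens !hcontract_counit_id counit_idM counit_idE !scalerA mulr_algl -!scalerAl.
Qed.

Lemma d0_balanced (a : A) :
  biadd_balanced (@counit F H) (fun k (u : M) => k%:A *: inner u a).
Proof.
have [l1 l2 l3] := @lact_H2linear F H A M; have [r1 r2 r3] := @ract_H2linear F H A M.
have [_ zD] := hlift_additive bic; have [_ zD'] := hlift_additive bci.
have [e1 _] := @counit_monoid F H.
split=> [k l u|k u v|k h u].
- by rewrite !scalerDl.
- rewrite -scalerDr; congr (_ *: _).
  rewrite /inner l2 r1 [hcontract _ (_ + _)]zD [X in _ - X]zD'.
  by rewrite opprD addrACA.
- rewrite /inner -[a in LHS]scale1r l3 r3.
  rewrite hcontract_id_counitZ hcontract_counit_idZ !scale1r -scalerBr.
  by rewrite scalerA -scalerAl mul1r scalerA.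
Qed.

Lemma d0_class (u : M) : d0 (class0 u) =1 inner u.
Proof.
move=> a; rewrite /d0 /class0 slift_tens; last exact: d0_balanced.
by rewrite !scale1r.
Qed.

Lemma hmapD n (V W : lmodType H) (f : V -> W) (x y : hten n V) : linear f ->
  hmap f (x + y) = hmap f x + hmap f y.
Proof. by move=> fL; have [_ zD] := hlift_additive (@hmap_balanced _ _ n _ _ _ fL); exact: zD. Qed.

Lemma hmapZ n (V W : lmodType H) (f : V -> W) p (x : hten n V) : linear f ->
  hmap f (p *: x) = p *: hmap f x.
Proof.
move=> fL; have [z0 zD] := hlift_additive (@hmap_balanced _ _ n _ _ _ fL).
elim/hten_ind: x => [|a b IHa IHb|q v].
- by rewrite scaler0 [hmap _ 0]z0 scaler0.
- by rewrite scalerDr !hmapD // IHa IHb scalerDr.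
by rewrite scale_htens !hmap_tens // scale_htens.
Qed.

Lemma d1_H2linear (phi : A -> M) : is_cochain1 phi -> is_cochain2 (d1 phi).
Proof.
move=> pL; have [l1 l2 l3] := @lact_H2linear F H A M.
have [r1 r2 r3] := @ract_H2linear F H A M.
have [m1 m2 m3] := @pmul_H2linear F H A.
have pD v w : phi (v + w) = phi v + phi w by have := pL 1 v w; rewrite !scale1r.
have p0 : phi 0 = 0 by apply: (addrI (phi 0)); rewrite -pD !addr0.
have pZ h v : phi (h *: v) = h *: phi v by have := pL h v 0; rewrite p0 !addr0.
rewrite /is_cochain2 /d1; split=> [a a' b|a b b'|h g a b].
- by rewrite pD l1 m1 r1 hmapD // opprD (AC (2*2*2) ((1*3*5)*(2*4*6))%AC).
- by rewrite pD l2 m2 r2 hmapD // opprD (AC (2*2*2) ((1*3*5)*(2*4*6))%AC).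
- by rewrite !pZ l3 m3 r3 hmapZ // scalerDr scalerBr.
Qed.

End HochschildLemmas.

(* Main.v *)
(** Applying the counit to the i-th tensor factor gives a face map
    [ci : H^{(x)3} (x)_H M -> H^{(x)2} (x)_H M], and [ci] of a triple product is
    a product of two elements, one of which has absorbed its neighbour:
      [f_u (a * b) = c3 ((a * b) * u) - c1 (u * (a * b))],
      [a * f_u b = c3 (a * (b * u)) - c2 (a * (u * b))],
      [f_u a * b = c2 ((a * u) * b) - c1 ((u * a) * b)].
    The three associativity axioms of the bimodule then give the Leibniz rule. *)

Require Import Defs.
From mathcomp Require Import all_boot all_order all_algebra.
From mathcomp Require Import boolp.

Import GRing.Theory.
Local Open Scope ring_scope.

(* [iterD] alone denotes the ssrnat lemma on [iter]. *)
Local Notation iterD := Defs.iterD.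

(** * Iterated comultiplications on three tensor factors, and face maps *)

Section Faces.
Set Implicit Arguments.
Unset Strict Implicit.
Variables (F : fieldType) (H : hopfAlgType F).

Lemma tpow3_eq (G : lmodType F) (f g : tpow H 3 -> G) : linear f -> linear g ->
  (forall x y z, f (tpure [tuple x; y; z]) = g (tpure [tuple x; y; z])) -> f =1 g.
Proof.
move=> fL gL fg; apply: linear_tlift_eq => // t.
have -> : t = [tuple tnth t (inord 0); tnth t (inord 1); tnth t (inord 2)].
  by apply: eq_from_tnth; apply: ord3P; rewrite [RHS](tnth_nth 0) inordK.
exact: fg.
Qed.

Lemma tri3M n m l (p q : tpow H 3) :
  tri3 n m l (p * q) = tri3 n m l p * tri3 n m l q.
Proof.
have L := @tri3_linear F H n m l.
move: p; apply: tpow3_eq => [||x y z].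
- exact: (linear_comp L (@tmul_linearl _ _ _ q)).
- exact: (linear_comp (@tmul_linearl _ _ _ (tri3 n m l q)) L).
move: q; apply: tpow3_eq => [||x' y' z'].
- exact: (linear_comp L (@tmul_linearr _ _ _ _)).
- exact: (linear_comp (@tmul_linearr _ _ _ _) L).
rewrite tpureM.
have -> : tuple_mul [tuple x; y; z] [tuple x'; y'; z'] =
          [tuple x * x'; y * y'; z * z'].
  by apply: eq_from_tnth; apply: ord3P; rewrite tnth_mktuple !(tnth_nth 0) !inordK.
have [_ nM] := @iterD_monoid F H n; have [_ mM] := @iterD_monoid F H m.
have [_ lM] := @iterD_monoid F H l.
by rewrite !tri3_pure nM mM lM !tcatM.
Qed.

(** Coassociativity: splitting a factor in two and the halves further, into [n] and [m], amounts to
    splitting it into [n + m]. With its mirror image below, this carries a face map through the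
    composition rule. *)
Lemma tri3_iterD2l n m l (q : tpow H 2) :
  tri3 n m l (iterD2 2 1 q) = iterD2 (n + m) l q.
Proof.
move: q; apply: tpow2_eq => [||x y].
- exact: (linear_comp (@tri3_linear F H n m l) (@iterD2_linear F H 2 1)).
- exact: iterD2_linear.
by rewrite !iterD2_pure iterD2E [iterD 1 y]/= tri3_catl iterD2_comul.
Qed.

Lemma tri3_iterD2r n m l (q : tpow H 2) :
  tri3 n m l (iterD2 1 2 q) =
  ecast k (tpow H k) (addnA n m l) (iterD2 n (m + l) q).
Proof.
move: q; apply: tpow2_eq => [||x y].
- exact: (linear_comp (@tri3_linear F H n m l) (@iterD2_linear F H 1 2)).
- exact: (linear_comp (@ecast_linear F H _ _ (addnA n m l)) (@iterD2_linear F H n (m + l))).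
by rewrite !iterD2_pure iterD2E [iterD 1 x]/= tri3_catr iterD2_comul.
Qed.

Lemma tri3_iterD n m l (h : H) : tri3 n m l (iterD 3 h) = iterD (n + m + l) h.
Proof. by rewrite -[3%N]/(2 + 1)%N -iterD2_comul tri3_iterD2l iterD2_comul. Qed.

Lemma tone1E : (1 : tpow H 1) = tpure [tuple 1].
Proof. by have [<- _] := @iterD_monoid F H 1. Qed.

Lemma tcat11 n m : tcat (1 : tpow H n) (1 : tpow H m) = 1.
Proof.
rewrite !tmul1E tcat_pure; congr tpure; apply: eq_from_tnth => i.
by case: (split_ordP i) => j ->; rewrite ?tnth_lshift ?tnth_rshift !tnth_mktuple.
Qed.

Lemma tcat1r n (p : tpow H n) :
  tcat p (1 : tpow H 0) = ecast k (tpow H k) (esym (addn0 n)) p.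
Proof.
move: p; apply: linear_tlift_eq => [||t].
- exact: tcat_linearl.
- exact: ecast_linear.
rewrite tmul1E tcat_pure tpure_ecast; congr tpure; apply: val_inj.
by rewrite val_ecast [X in cat_tuple _ X]tuple0 /= cats0.
Qed.

Lemma tone0E : (1 : tpow H 0) = tpure [tuple].
Proof. by rewrite tmul1E tuple0. Qed.

(** [iterD 0] is the counit, so it leaves a scalar, which passes through the linear [iterD n]. *)
Lemma iterD2_id_counit n (p : tpow H 2) :
  iterD2 n 0 p = ecast k (tpow H k) (esym (addn0 n)) (iterD n (id_counit p)).
Proof.
have ce := @ecast_linear F H _ _ (esym (addn0 n)).
have nL := @iterD_linear F H n.
move: p; apply: tpow2_eq => [||x y].
- exact: iterD2_linear.
- exact: (linear_comp ce (linear_comp nL (@id_counit_linear F H))).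
rewrite iterD2_pure id_counitE (linZ _ _ nL) (linZ _ _ ce) [iterD 0 y]/= -tone0E.
by rewrite [LHS](linZ _ _ (tcat_linearr _)) tcat1r.
Qed.

Lemma iterD2_counit_id n (p : tpow H 2) : iterD2 0 n p = iterD n (counit_id p).
Proof.
have nL := @iterD_linear F H n.
move: p; apply: tpow2_eq => [||x y].
- exact: (@iterD2_linear F H 0 n).
- exact: (linear_comp nL (@counit_id_linear F H)).
rewrite iterD2_pure counit_idE (linZ _ _ nL) [iterD 0 x]/=.
by rewrite [LHS](linZ _ _ (tcat_linearl _)) tcat0l.
Qed.

Lemma iterD2_11 (p : tpow H 2) : iterD2 1 1 p = p.
Proof.
move: p; apply: tpow2_eq => //; first exact: (@iterD2_linear F H 1 1).
by move=> x y; rewrite iterD2_pure tcat_pure; congr tpure; exact: val_inj.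
Qed.

Lemma hlift_push k (V : lmodType H) (G G' : zmodType) (g : G -> G')
    (b : tpow H k -> V -> G) (x : hten k V) :
  g 0 = 0 -> {morph g : y z / y + z} ->
  g (hlift b x) = hlift (fun p v => g (b p v)) x.
Proof. by move=> g0 gD; rewrite /hlift /slift /plift (big_morph g gD g0). Qed.

(* [tri3 n m l] is [Delta^(n-1) (x) Delta^(m-1) (x) Delta^(l-1)], which is the
   counit on a factor of index 0, so [hface3 1 1 0], [hface3 1 0 1] and
   [hface3 0 1 1] are [c3], [c2] and [c1]. *)
Definition hface3 (V : lmodType H) n m l : hten 3 V -> hten (n + m + l) V :=
  hlift (fun p v => htens (tri3 n m l p) v).

(** A face map as seen by the two factors of an inner product: an index 0 contracts a factor by the
    counit. *)
Definition hface2 (V : lmodType H) n m : hten 2 V -> hten (n + m) V :=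
  hlift (fun p v => htens (iterD2 n m p) v).

(** The face is well defined over [H] because [tri3] is multiplicative and turns the action through
    [iterD 3] into the one through [iterD (n + m + l)]. *)
Lemma hface3_balanced (V : lmodType H) n m l :
  biadd_balanced (@Defs.iterD F H 3)
    (fun p (v : V) => htens (tri3 n m l p) v).
Proof.
have [b1 b2 b3] := @htens_balanced F H (n + m + l) V.
split=> [p q v|p v w|p h v]; rewrite ?b2 ?b3 //.
  by rewrite (linD _ _ (@tri3_linear F H n m l)) b1.
by rewrite tri3M tri3_iterD.
Qed.

Lemma hface2_balanced (V : lmodType H) n m :
  biadd_balanced (@Defs.iterD F H 2) (fun p (v : V) => htens (iterD2 n m p) v).
Proof.
have [b1 b2 b3] := @htens_balanced F H (n + m) V.
have [_ dM] := iterD2_monoid (@iterD_monoid F H n) (@iterD_monoid F H m).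
split=> [p q v|p v w|p h v]; rewrite ?b2 ?b3 //.
  by rewrite (linD _ _ (@iterD2_linear F H n m)) b1.
by rewrite dM iterD2E iterD2_comul.
Qed.

Lemma hface2_id (V : lmodType H) (x : hten 2 V) : hface2 1 1 x = x.
Proof.
have [z0 zD] := hlift_additive (@hface2_balanced V 1 1).
rewrite /hface2; elim/hten_ind: x => [|a b IHa IHb|p u].
- exact: z0.
- by rewrite [LHS]zD IHa IHb.
rewrite hlift_tens; last exact: hface2_balanced.
by rewrite iterD2_11.
Qed.

(** * Face maps and the composition rule *)

Section Composition.
Variables (V1 V2 V3 : lmodType H) (op : V1 -> V2 -> hten 2 V3).
Hypothesis opL : H2linear op.

Lemma pext0l n m (b : hten m V2) : pext op (0 : hten n V1) b = 0.
Proof. by apply: (addrI (pext op (0 : hten n V1) b)); rewrite -pextDl // !addr0. Qed.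

Lemma pext0r n m (a : hten n V1) : pext op a (0 : hten m V2) = 0.
Proof. by apply: (addrI (pext op a (0 : hten m V2))); rewrite -pextDr // !addr0. Qed.

Lemma pext_hunit v w : pext op (hunit v) (hunit w) = op v w.
Proof.
rewrite /hunit pext_tens // tcat11 -[RHS]hface2_id.
by apply: eq_hlift => p u; rewrite mul1r.
Qed.

(** The indices split along the bracketing: [n] and [m] go to the inner product [x], [l] goes to
    [c]. On generators this is multiplicativity of [tri3] together with coassociativity. *)
Lemma hface3_compl n m l (x : hten 2 V1) (c : V2) :
  hface3 n m l (pext op x (hunit c)) =
  pext op (hface2 n m x) (htens (1 : tpow H l) c).
Proof.
have [z0 zD] := hlift_additive (@hface3_balanced V3 n m l).
have [y0 yD] := hlift_additive (@hface2_balanced V1 n m).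
rewrite /hface3 /hface2; elim/hten_ind: x => [|a b IHa IHb|p v].
- by rewrite pext0l [LHS]z0 y0 pext0l.
- by rewrite pextDl // [LHS]zD yD pextDl // IHa IHb.
rewrite hlift_tens; last exact: hface2_balanced.
rewrite /hunit !pext_tens // hlift_push //.
apply: eq_hlift => q u; rewrite hlift_tens; last exact: hface3_balanced.
have [l1 _] := @iterD_monoid F H l.
by rewrite tri3M tone1E tri3_catl tri3_iterD2l l1.
Qed.

Lemma hface3_compr n m l (a : V1) (x : hten 2 V2) :
  hface3 n m l (pext op (hunit a) x) =
  ecast k (hten k V3) (addnA n m l)
    (pext op (htens (1 : tpow H n) a) (hface2 m l x)).
Proof.
have [z0 zD] := hlift_additive (@hface3_balanced V3 n m l).
have [y0 yD] := hlift_additive (@hface2_balanced V2 m l).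
(* The cast along an equality of degrees is additive: eliminating the equality turns it into the
   identity. *)
have [e0 eD] : let g y := ecast k (hten k V3) (addnA n m l) y in
  g 0 = 0 /\ {morph g : y z / y + z} by case: _ / (addnA n m l).
rewrite /hface3 /hface2; elim/hten_ind: x => [|x y IHx IHy|p v].
- by rewrite pext0r [LHS]z0 y0 pext0r e0.
- by rewrite pextDr // [LHS]zD yD pextDr // IHx IHy eD.
rewrite hlift_tens; last exact: hface2_balanced.
rewrite /hunit !pext_tens // [LHS]hlift_push //.
rewrite [RHS](hlift_push (g := fun y => ecast k (hten k V3) (addnA n m l) y)) //.
apply: eq_hlift => q u; rewrite hlift_tens; last exact: hface3_balanced.
have [n1 _] := @iterD_monoid F H n.
rewrite tri3M tone1E tri3_catr tri3_iterD2r n1.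
by case: _ / (addnA n m l).
Qed.

End Composition.

(** * Contraction of a factor by the counit *)

Section Counit.
Variables (V1 V2 V3 : lmodType H) (op : V1 -> V2 -> hten 2 V3).
Hypothesis opL : H2linear op.

(** The surviving coefficient lies in [H] and moves across the tensor sign, as in the identification
    of [hten 1 V] with [V]. *)
Lemma hface2_id_counit (V : lmodType H) (x : hten 2 V) :
  hface2 1 0 x = hunit (hcontract (@id_counit F H) x).
Proof.
have [z0 zD] := hlift_additive (@hface2_balanced V 1 0).
have [y0 yD] := hlift_additive (@id_counit_balanced F H V).
have [b1 b2 b3] := @htens_balanced F H 1 V.
rewrite /hface2 /hunit; elim/hten_ind: x => [|x y IHx IHy|p v].
- rewrite [LHS]z0 [hcontract _ 0]y0.
  by apply: (addrI (htens 1 0)); rewrite -b2 !addr0.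
- by rewrite [LHS]zD IHx IHy [hcontract _ (x + y)]yD b2.
rewrite [LHS]hlift_tens; last exact: hface2_balanced.
by rewrite hcontract_id_counit b3 mul1r iterD2_id_counit (eq_axiomK (esym (addn0 1))).
Qed.

Lemma hface2_counit_id (V : lmodType H) (x : hten 2 V) :
  hface2 0 1 x = hunit (hcontract (@counit_id F H) x).
Proof.
have [z0 zD] := hlift_additive (@hface2_balanced V 0 1).
have [y0 yD] := hlift_additive (@counit_id_balanced F H V).
have [b1 b2 b3] := @htens_balanced F H 1 V.
rewrite /hface2 /hunit; elim/hten_ind: x => [|x y IHx IHy|p v].
- rewrite [LHS]z0 [hcontract _ 0]y0.
  by apply: (addrI (htens 1 0)); rewrite -b2 !addr0.
- by rewrite [LHS]zD IHx IHy [hcontract _ (x + y)]yD b2.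
rewrite [LHS]hlift_tens; last exact: hface2_balanced.
by rewrite hcontract_counit_id b3 mul1r iterD2_counit_id.
Qed.

(** With [c] placed in degree 0, its slot carries only counits, so multiplying by [c] is a
    contraction under [hten 2]. Linearity of that contraction makes [hmap] well defined. *)
Lemma pext_counitr (x : hten 2 V1) (c : V2) :
  linear (fun v => hcontract (@id_counit F H) (op v c)) ->
  pext op x (htens (1 : tpow H 0) c) =
  hmap (fun v => hcontract (@id_counit F H) (op v c)) x.
Proof.
move=> fL; have [z0 zD] := hlift_additive (hmap_balanced 2 fL).
have [b1 b2 b3] := @htens_balanced F H 2 V3.
rewrite /hmap; elim/hten_ind: x => [|x y IHx IHy|p v].
- by rewrite pext0l // z0.
- by rewrite pextDl // zD IHx IHy.
rewrite pext_tens // -/(hmap _ _) hmap_tens // /hcontract.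
have h0 : htens p (0 : V3) = 0.
  by apply: (addrI (htens p 0)); rewrite -b2 !addr0.
rewrite [RHS]hlift_push //; apply: eq_hlift => q u.
rewrite b3 iterD2_id_counit tcat1r.
by rewrite !(eq_axiomK (esym (addn0 2))).
Qed.

Lemma pext_counitl (a : V1) (x : hten 2 V2) :
  linear (fun v => hcontract (@counit_id F H) (op a v)) ->
  pext op (htens (1 : tpow H 0) a) x =
  hmap (fun v => hcontract (@counit_id F H) (op a v)) x.
Proof.
move=> fL; have [z0 zD] := hlift_additive (hmap_balanced 2 fL).
have [b1 b2 b3] := @htens_balanced F H 2 V3.
rewrite /hmap; elim/hten_ind: x => [|x y IHx IHy|p v].
- by rewrite pext0r // z0.
- by rewrite pextDr // zD IHx IHy.
rewrite pext_tens // -/(hmap _ _) hmap_tens // /hcontract.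
have h0 : htens p (0 : V3) = 0.
  by apply: (addrI (htens p 0)); rewrite -b2 !addr0.
rewrite [RHS]hlift_push //; apply: eq_hlift => q u.
by rewrite b3 iterD2_counit_id tone0E tcat0l.
Qed.

End Counit.

Lemma H2linearBl (V1 V2 V3 : lmodType H) (op : V1 -> V2 -> hten 2 V3) v v' w :
  H2linear op -> op (v - v') w = op v w - op v' w.
Proof. by move=> [l1 _ _]; apply: (addIr (op v' w)); rewrite -l1 !subrK. Qed.

Lemma H2linearBr (V1 V2 V3 : lmodType H) (op : V1 -> V2 -> hten 2 V3) v w w' :
  H2linear op -> op v (w - w') = op v w - op v w'.
Proof. by move=> [_ l2 _]; apply: (addIr (op v w')); rewrite -l2 !subrK. Qed.

Lemma hmapB n (V W : lmodType H) (f g : V -> W) (x : hten n V) :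
  hmap (fun v => f v - g v) x = hmap f x - hmap g x.
Proof.
have [_ b2 _] := @htens_balanced F H n W.
apply: (addIr (hmap g x)); rewrite subrK -hlift_add_fun.
by apply: eq_hlift => p v; rewrite -b2 subrK.
Qed.

(** * The three contracted associativity laws *)

Section Leibniz.
Variables (A M : lmodType H).
Variables (m : A -> A -> hten 2 A) (l : A -> M -> hten 2 M) (r : M -> A -> hten 2 M).
Hypotheses (mL : H2linear m) (lL : H2linear l) (rL : H2linear r).
Variable u : M.

Let lc (a : A) : M := hcontract (@id_counit F H) (l a u).
Let rc (a : A) : M := hcontract (@counit_id F H) (r u a).
Hypotheses (lcL : linear lc) (rcL : linear rc).

(** The face [1, 0, 1] contracts the slot of [u], which merges with [a] on one side and with [b] on
    the other. *)
Lemma contract_lr a b :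
  pcompl r l a u b = pcompr l r a u b -> r (lc a) b = l a (rc b).
Proof.
move=> /(congr1 (hface3 1 0 1)); rewrite /pcompl /pcompr hface3_compl //.
(* For these numerals the cast runs along a proof of [2 = 2]; such proofs are unique, so it is the
   identity. *)
rewrite hface3_compr // (eq_axiomK (addnA 1 0 1)) hface2_id_counit.
by rewrite hface2_counit_id -!/(hunit _) !pext_hunit.
Qed.

(** The face [1, 1, 0] contracts the slot of [u], which meets the whole product of [a] and [b] on
    one side and only [b] on the other. *)
Lemma contract_l a b : pcompl l m a b u = pcompr l l a b u ->
  hmap lc (m a b) = l a (lc b).
Proof.
move=> /(congr1 (hface3 1 1 0)); rewrite /pcompl /pcompr hface3_compl //.
rewrite hface3_compr // (eq_axiomK (addnA 1 1 0)) hface2_id_counit.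
by rewrite -!/(hunit _) pext_hunit // hface2_id pext_counitr.
Qed.

Lemma contract_r a b : pcompl r r u a b = pcompr r m u a b ->
  hmap rc (m a b) = r (rc a) b.
Proof.
move=> /(congr1 (hface3 0 1 1)); rewrite /pcompl /pcompr hface3_compl //.
rewrite hface3_compr // (eq_axiomK (addnA 0 1 1)) hface2_counit_id.
by rewrite -!/(hunit _) pext_hunit // hface2_id pext_counitl.
Qed.

End Leibniz.

End Faces.

(** * Inner derivations and the Hochschild differentials *)

Section Inner.
Set Implicit Arguments.
Unset Strict Implicit.
Variables (F : fieldType) (H : hopfAlgType F) (A : pseudoAlgType H).
Variable M : pseudoBimodType A.

Lemma lact_contract_linear (u : M) :
  linear (fun a : A => hcontract (@id_counit F H) (lact a u)).
Proof.
have [l1 l2 l3] := @lact_H2linear F H A M.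
have [_ zD] := hlift_additive (@id_counit_balanced F H M).
have [e1 _] := @counit_monoid F H.
move=> h a b; rewrite l1 [LHS]zD; congr (_ + _).
(* Writing [u] as [1 *: u] brings in linearity over the tensor square; [h] sits in the retained slot
   and the other contributes [counit 1 = 1]. *)
by rewrite -[u in LHS]scale1r l3 [LHS]hcontract_id_counitZ e1 !scale1r.
Qed.

Lemma ract_contract_linear (u : M) :
  linear (fun a : A => hcontract (@counit_id F H) (ract u a)).
Proof.
have [r1 r2 r3] := @ract_H2linear F H A M.
have [_ zD] := hlift_additive (@counit_id_balanced F H M).
have [e1 _] := @counit_monoid F H.
move=> h a b; rewrite r2 [LHS]zD; congr (_ + _).
by rewrite -[u in LHS]scale1r r3 [LHS]hcontract_counit_idZ e1 !scale1r.
Qed.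

Lemma inner_linear (u : M) : linear (fun a : A => inner u a).
Proof.
move=> h a b; rewrite /inner lact_contract_linear ract_contract_linear.
by rewrite scalerBr opprD addrACA.
Qed.

Lemma inner_derivation (u : M) : is_derivation (fun a : A => inner u a).
Proof.
split=> [|a b]; first exact: inner_linear.
have lL := @lact_H2linear F H A M; have rL := @ract_H2linear F H A M.
rewrite /inner hmapB (H2linearBr _ _ _ lL) (H2linearBl _ _ _ rL).
rewrite (contract_l lL (lact_contract_linear u) (lactA a b u)).
rewrite (contract_r rL (ract_contract_linear u) (ractA u a b)).
(* The two mixed terms, with [u] between [a] and [b], are equal and cancel. *)
by rewrite (contract_lr lL rL (lractA a u b)) subrKA.
Qed.

(** Scalars lift to [H]: since [counit k%:A = k], a generator with coefficient [k] is the class of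
    [k%:A *: u], and classes are closed under sums. *)
Lemma cochain0_class (c : cochain0 M) : exists u : M, c = class0 u.
Proof.
have [_ b2 b3] := stens_balanced (@counit F H) M.
have [e1 _] := @counit_monoid F H.
rewrite /class0; elim/scext_ind: c => [|c c' [u ->] [v ->]|k u].
- by exists 0; apply: (addrI (stens (@counit F H) 1 (0 : M))); rewrite -b2 !addr0.
- by exists (u + v); rewrite b2.
- exists (k%:A *: u); rewrite b3 mul1r.
  have -> : counit (k%:A : H) = k; last by [].
  by rewrite (linZ (V := F^o) _ _ (@counit_linear F H)) e1; exact: mulr1.
Qed.

Lemma derivation_d1 (f : A -> M) a b : is_derivation f -> d1 f a b = 0.
Proof. by move=> [_ fM]; rewrite /d1 fM opprD addrA subrr sub0r addNr. Qed.

End Inner.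

Theorem proposition3p1 (F : fieldType) (charF : [pchar F] =i pred0)
    (H : hopfAlgType F) (A : pseudoAlgType H) (M : pseudoBimodType A) :
  [/\ forall u : M, linear (fun a : A => inner u a),
      forall u : M, is_derivation (fun a : A => inner u a) &
      forall c : cochain0 M,
        is_cochain1 (d0 c) /\ forall a b : A, d1 (d0 c) a b = 0].
Proof.
split=> [u|u|c]; [exact: inner_linear | exact: inner_derivation |].
have [u ->] := cochain0_class c.
have -> : d0 (class0 u) = inner u by apply/funext; exact: d0_class.
split=> [|a b]; first exact: inner_linear.
by apply: derivation_d1; exact: inner_derivation.
Qed.
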